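(* Let $G$ be a finite group of order $v$ and let $n\ge 2$. If $G$ allows a regular set of (anti)automorphisms of size $n-1$, then any $(v,k,\lambda)$ difference set in $G$ extends to dimension $n$.
   Context: Groups are written additively but are not necessarily abelian. A $(v,k,\lambda)$ difference set in a group $G$ of order $v$ is a $k$-subset $D\subseteq G$ such that every $g\in G\setminus\{0\}$ can be written as $g=a-b$ with $a,b\in D$ in exactly $\lambda$ ways. An $n$-dimensional $(v,k,\lambda)$ difference set in $G$ is a $k$-subset $E\subseteq G^n$ of $n$-tuples such that for every pair of coordinates $1\le x<y\le n$ the set $\{e_x-e_y\mid e\in E\}$ is a $(v,k,\lambda)$ difference set in $G$. A $(v,k,\lambda)$ difference set $D\subseteq G$ extends to dimension $n$ if there is an $n$-dimensional $(v,k,\lambda)$ difference set $E\subseteq G^n$ and two distinct coordinates $x\ne y$ such that $D=\{e_x-e_y\mid e\in E\}$. An antiautomorphism of $G$ is a bijection $\varphi:G\to G$ such that $\varphi(g+h)=\varphi(h)+\varphi(g)$ for all $g,h\in G$. A set $R=\{\varphi_1,\ldots,\varphi_{n-1}\}$ of $n-1$ functions is a regular set of (anti)automorphisms of $G$ if each $\varphi_x:G\to G$ is an automorphism or antiautomorphism, and each difference $\varphi_x-\varphi_y$, defined by $(\varphi_x-\varphi_y)(g)=\varphi_x(g)-\varphi_y(g)$, is an automorphism or antiautomorphism for $1\le x<y\le n-1$. *)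

(* Defs.v *)
From mathcomp Require Import all_boot all_fingroup.

Set Implicit Arguments.
Unset Strict Implicit.
Unset Printing Implicit Defensive.

Local Open Scope group_scope.

(* The group G is a whole finGroupType, written multiplicatively: the additive *)
(* a - b becomes a * b^-1, and 0 becomes 1. G is not assumed commutative.      *)

Section DifferenceSets.

Variable gT : finGroupType.

Definition difference_set (v k lambda : nat) (D : {set gT}) : Prop :=
  [/\ #|gT| = v,
      #|D| = k
    & forall g : gT, g != 1 ->
        #|[set ab : gT * gT |
             [&& ab.1 \in D, ab.2 \in D & g == ab.1 * ab.2^-1]]| = lambda].

Definition coord_diff (n : nat) (E : {set {ffun 'I_n -> gT}}) (x y : 'I_n) :
    {set gT} :=
  [set e x * (e y)^-1 | e : {ffun 'I_n -> gT} in E].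

Definition ndim_difference_set (n v k lambda : nat)
    (E : {set {ffun 'I_n -> gT}}) : Prop :=
  #|E| = k /\
  (forall x y : 'I_n, (x < y)%N ->
     difference_set v k lambda (coord_diff E x y)).

Definition extends_to_dimension (n v k lambda : nat) (D : {set gT}) : Prop :=
  exists E : {set {ffun 'I_n -> gT}},
    ndim_difference_set v k lambda E /\
    (exists x y : 'I_n, x != y /\ D = coord_diff E x y).

Definition automorphism (f : gT -> gT) : Prop :=
  bijective f /\ (forall g h, f (g * h) = f g * f h).

Definition antiautomorphism (f : gT -> gT) : Prop :=
  bijective f /\ (forall g h, f (g * h) = f h * f g).

Definition auto_or_antiauto (f : gT -> gT) : Prop :=
  automorphism f \/ antiautomorphism f.

(* Since phi enumerates R by 'I_#|R|, it is automatically injective. *)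
Definition regular_set (R : {set {ffun gT -> gT}}) : Prop :=
  exists phi : 'I_#|R| -> {ffun gT -> gT},
    [/\ R = [set phi x | x : 'I_#|R|],
        forall x, auto_or_antiauto (phi x)
      & forall x y : 'I_#|R|, (x < y)%N ->
          auto_or_antiauto (fun g => phi x g * (phi y g)^-1)].

End DifferenceSets.

(* Main.v *)
Require Import Defs.
From mathcomp Require Import all_boot all_fingroup.

(** Put [e_0 = 1] and [e_i = phi_i d'] for [1 <= i < n], with [d'] ranging over
    [phi_1^-1 D]: the quotients of coordinates are then images of [phi_1^-1 D]
    under (anti)automorphisms, possibly followed by inversion, and
    [e_1 e_0^-1] runs over [D]. Everything reduces to the fact that [D^-1] is a
    difference set when [D] is. To see this, let [r g] and [s g] count the pairs
    of [D] with [a b^-1 = g] and [a^-1 b = g]. They have the same sum, and also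
    the same sum of squares because [a^-1 b = c^-1 d] iff [c a^-1 = d b^-1];
    since [r] is constant off the identity, the variance of [s] there is [0]. *)

Set Implicit Arguments.
Unset Strict Implicit.
Unset Printing Implicit Defensive.

Section Fibers.

Variables (T S : finType) (P : {set T}) (F : T -> S).

Lemma sum_card_fiber : (\sum_g #|[set p in P | F p == g]| = #|P|)%N.
Proof.
rewrite -[RHS]sum1_card (partition_big F predT) //=.
by apply: eq_bigr => g _; rewrite -sum1_card; apply: eq_bigl => p; rewrite inE.
Qed.

(** A squared fibre size counts the ordered pairs inside that fibre, so the sum of squares counts
    the collisions of [F]. *)
Lemma sum_card_fiber_sqr :
  (\sum_g #|[set p in P | F p == g]| ^ 2 =
   #|[set pq : T * T | [&& pq.1 \in P, pq.2 \in P & F pq.1 == F pq.2]]|)%N.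
Proof.
rewrite -[RHS]sum1_card (partition_big (F \o fst) predT) //=.
apply: eq_bigr => g _; rewrite -mulnn -cardsX -sum1_card; apply: eq_bigl => -[p q].
rewrite !inE /=; case: (p \in P); case: (q \in P); rewrite ?andbF //=.
by case: (F p =P g) => [->|]; rewrite ?andbF // andbT eq_sym.
Qed.

End Fibers.

Section DifferenceSetTransport.

Local Open Scope group_scope.

Variable gT : finGroupType.
Implicit Types (D : {set gT}) (f : gT -> gT).

Local Notation rdiv := (fun p : gT * gT => p.1 * p.2^-1).
Local Notation ldiv := (fun p : gT * gT => p.1^-1 * p.2).

Lemma sum_sqr_ldiv D :
  (\sum_g #|[set p in setX D D | ldiv p == g]| ^ 2 =
   \sum_g #|[set p in setX D D | rdiv p == g]| ^ 2)%N.
Proof.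
rewrite !sum_card_fiber_sqr.
(* [h] sends [((a, b), (c, d))] to [((c, a), (d, b))], turning collisions of [ldiv] into collisions
   of [rdiv]. *)
pose h (t : (gT * gT) * (gT * gT)) := ((t.2.1, t.1.1), (t.2.2, t.1.2)).
have h_inj : injective h by move=> [[a b] [c d]] [[a' b'] [c' d']] [-> -> -> ->].
rewrite -(card_imset _ h_inj); apply: eq_card => -[[c a] [d b]].
rewrite (_ : ((c, a), (d, b)) = h ((a, b), (c, d))) // mem_imset // !inE /=.
rewrite (_ : (a^-1 * b == c^-1 * d) = (c * a^-1 == d * b^-1)).
  by case: (a \in D); case: (b \in D); case: (c \in D); case: (d \in D).
(* Both equations amount to [c * a^-1 * b = d]. *)
by rewrite -(inj_eq (mulgI c)) mulKVg mulgA -[RHS](inj_eq (mulIg b)) mulgKV.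
Qed.

Lemma card_quotient_pairs D g :
  #|[set ab : gT * gT | [&& ab.1 \in D, ab.2 \in D & g == ab.1 * ab.2^-1]]| =
  #|[set p in setX D D | rdiv p == g]|.
Proof. by apply: eq_card => p; rewrite !inE -andbA eq_sym. Qed.

Lemma card_diagonal_fiber (D : {set gT}) (F : gT * gT -> gT) :
  (forall a b, (F (a, b) == 1) = (a == b)) ->
  #|[set p in setX D D | F p == 1]| = #|D|.
Proof.
move=> F1; have dI : injective (fun a : gT => (a, a)) by move=> a b [].
rewrite -(card_imset _ dI); apply: eq_card => -[a b]; rewrite !inE /= F1.
apply/idP/imsetP => [/andP[/andP[aD _] /eqP <-]|]; first by exists a.
by case=> c cD [-> ->]; rewrite cD eqxx.
Qed.

Lemma card_ldiv v k l D : difference_set v k l D ->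
  forall g, g != 1 -> #|[set p in setX D D | ldiv p == g]| = l.
Proof.
case=> _ _ dD; set s := fun g => #|[set p in setX D D | ldiv p == g]|.
set r := fun g => #|[set p in setX D D | rdiv p == g]|.
have s1 : s 1 = #|D|.
  by apply: card_diagonal_fiber => a b /=; rewrite -eq_mulVg1.
have r1 : r 1 = #|D|.
  by apply: card_diagonal_fiber => a b /=; rewrite -eq_mulgV1.
have sumD1 (F : gT -> nat) : (\sum_g F g = F 1%g + \sum_(g | g != 1%g) F g)%N.
  exact: bigD1.
have rE g : g != 1 -> r g = l by move=> /dD; rewrite card_quotient_pairs.
(* Both full sums count all pairs of [D], and both terms at the identity equal [#|D|]; cancel
   these. *)
have sum_s : (\sum_(g : gT | g != 1%g) s g = \sum_(g : gT | g != 1%g) l)%N.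
  apply/eqP; rewrite -(eqn_add2l #|D|); apply/eqP.
  by rewrite -(eq_bigr _ rE) -{1}s1 -r1 -!sumD1 !sum_card_fiber.
have sum_s2 : (\sum_(g : gT | g != 1%g) s g ^ 2 = \sum_(g : gT | g != 1%g) l ^ 2)%N.
  apply/eqP; rewrite -(eqn_add2l (#|D| ^ 2)); apply/eqP.
  rewrite -(eq_bigr _ (fun g g1 => congr1 (expn^~ 2) (rE g g1))).
  rewrite -{1}s1 -r1.
  by rewrite -(sumD1 (fun g => s g ^ 2)%N) -(sumD1 (fun g => r g ^ 2)%N) sum_sqr_ldiv.
(* The variance argument without subtraction: summed over [g != 1], the bound
   [2 * (s g * l) <= s g ^ 2 + l ^ 2] is an equality by [sum_s] and [sum_s2], hence an equality
   termwise, which forces [s g = l]. *)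
have [_] := leqif_sum (fun g (_ : g != 1) => nat_Cauchy (s g) l).
rewrite [X in _ == X]big_split /= sum_s2 -[X in X == _]big_distrr /=.
rewrite -[X in (2 * X)%N]big_distrl /= sum_s big_distrl /= mul2n addnn.
by rewrite eqxx => /esym/forall_inP s_l g /s_l/eqP.
Qed.

(** Right quotients of inverses, [a^-1 * (b^-1)^-1], are left quotients of [D], counted by
    [card_ldiv]. *)
Lemma difference_set_inv v k l D : difference_set v k l D ->
  difference_set v k l [set x^-1 | x in D].
Proof.
move=> dD; have := card_ldiv dD; case: dD => vE kE _ lE; split=> //.
  by rewrite (card_imset _ invg_inj).
move=> g /lE <-; rewrite card_quotient_pairs.
pose h (p : gT * gT) := (p.1^-1, p.2^-1).
have h_inj : injective h by move=> [a b] [c d] [/invg_inj-> /invg_inj->].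
rewrite -[RHS](card_imset _ h_inj); apply: eq_card => -[a b].
rewrite -[a]invgK -[b]invgK -[(_, _)]/(h (a^-1, b^-1)) (mem_imset _ _ h_inj).
by rewrite !inE /= !(mem_imset _ _ invg_inj) !invgK.
Qed.

Lemma difference_set_auto v k l D f : automorphism f ->
  difference_set v k l D -> difference_set v k l (f @: D).
Proof.
case=> -[f' fK f'K] fM [vE kE dD]; have f_inj := can_inj fK.
have f1 : f 1 = 1 by apply: (mulgI (f 1)); rewrite -fM !mulg1.
have fV x : f x^-1 = (f x)^-1.
  by apply: (mulgI (f x)); rewrite -fM !mulgV.
split=> //; first by rewrite (card_imset _ f_inj).
move=> g g1; rewrite -(dD (f' g)); last by rewrite -(inj_eq f_inj) f'K f1.
pose h (p : gT * gT) := (f p.1, f p.2).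
have h_inj : injective h by move=> [a b] [c d] [/f_inj-> /f_inj->].
rewrite -[RHS](card_imset _ h_inj); apply: eq_card => -[a b].
rewrite -[a]f'K -[b]f'K -[(_, _)]/(h (f' a, f' b)) (mem_imset _ _ h_inj).
by rewrite !inE /= !(mem_imset _ _ f_inj) -fV -fM -[in LHS](f'K g) (inj_eq f_inj).
Qed.

(** An antiautomorphism followed by inversion is an automorphism; the extra inversion is then undone
    by [difference_set_inv]. *)
Lemma difference_set_auto_or_anti v k l D f : auto_or_antiauto f ->
  difference_set v k l D -> difference_set v k l (f @: D).
Proof.
case=> [|[f_bij fM] dD]; first exact: difference_set_auto.
have /difference_set_auto/(_ dD)/difference_set_inv : automorphism (invg \o f).
  split=> [|g h]; last by rewrite /= fM invMg.
  by apply: bij_comp => //; exists invg; exact: invgK.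
by rewrite -imset_comp (eq_imset _ (g := f)) // => x /=; rewrite invgK.
Qed.

Lemma auto_or_antiauto_inv f f' : cancel f f' -> cancel f' f ->
  auto_or_antiauto f -> auto_or_antiauto f'.
Proof.
move=> fK f'K; have f'_bij : bijective f' by exists f.
by case=> -[_ fM]; [left|right]; split=> // g h;
  apply: (can_inj fK); rewrite fM !f'K.
Qed.

End DifferenceSetTransport.

Theorem theorem4p7 (gT : finGroupType) (v n : nat)
    (hv : #|gT| = v) (hn : 2 <= n)
    (hR : exists R : {set {ffun gT -> gT}}, regular_set R /\ #|R| = n - 1)
    (k lambda : nat) (D : {set gT}) (hD : difference_set v k lambda D) :
  extends_to_dimension n v k lambda D.
Proof.
case: hR => R [[phi [_ phiA phiB]] cR].
case: n hn cR => [|[|m]] // _; rewrite subSS subn0 => cR.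
(* The index type of [phi] becomes ['I_m.+1], which makes [ord0] and [lift ord0] available. *)
case: _ / (esym cR) phi phiA phiB => phi phiA phiB.
have [f' fK f'K] : bijective (phi ord0) by case: (phiA ord0) => -[].
set D' := f' @: D; have dD' : difference_set v k lambda D'.
  by apply: difference_set_auto_or_anti hD; apply: auto_or_antiauto_inv (phiA ord0).
(* [unlift ord0] is [None] exactly at coordinate 0; coordinate [j + 1] carries [phi j], so
   [phi ord0] is the map called [phi_1] above. *)
pose e (d : gT) : {ffun 'I_m.+2 -> gT} :=
  [ffun i => if unlift ord0 i is Some j then phi j d else 1%g].
have e0 d : e d ord0 = 1%g by rewrite ffunE unlift_none.
have eS d j : e d (lift ord0 j) = phi j d by rewrite ffunE liftK.
have e_inj : injective e.
  by move=> c d /ffunP/(_ (lift ord0 ord0)); rewrite !eS => /(can_inj fK).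
have diffE x y : coord_diff (e @: D') x y = [set (e d x * (e d y)^-1)%g | d in D'].
  by rewrite /coord_diff -imset_comp.
exists (e @: D'); split; last first.
  (* The order of the coordinates matters: the pair (1, 0) yields [D], while (0, 1) would yield its
     inverse. *)
  exists (lift ord0 ord0), ord0; split=> //; rewrite diffE -imset_comp -[LHS]imset_id.
  by apply: eq_imset => d /=; rewrite eS e0 f'K invg1 mulg1.
split=> [|x y]; first by rewrite (card_imset _ e_inj); case: dD'.
rewrite diffE; case: (unliftP ord0 y) => [j ->|-> //].
case: (unliftP ord0 x) => [i ->|-> _].
  (* Two nonzero coordinates: regularity makes the quotient map itself an (anti)automorphism. *)
  rewrite ltnS => /phiB/difference_set_auto_or_anti/(_ dD').
  by congr difference_set; apply: eq_imset => d; rewrite !eS.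
(* Here [x = 0], and the quotients are the inverses of the elements of [phi j @: D']. *)
have := difference_set_inv (difference_set_auto_or_anti (phiA j) dD').
by rewrite -imset_comp; congr difference_set; apply: eq_imset => d;
  rewrite /= e0 eS mul1g.
Qed.
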